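(* The length of the 3-cocycle $\eta$ of the octahedral quandle $O_6$ (with $O_6$ and $\eta$ as defined in the context) is equal to eight, i.e. $l(\eta)=8$.
   Context: A quandle is a non-empty set $X$ with a binary operation $(a,b)\mapsto a^b$ such that $a^a=a$ for all $a$; for each $y\in X$ the map $x\mapsto x^y$ is bijective; and $(a^b)^c=(a^c)^{(b^c)}$ for all $a,b,c$. The associated group is $G(X)=\langle X\mid b^{-1}ab\,(a^b)^{-1}\ (a,b\in X)\rangle$. An $X$-set is a set $S$ with a right action $(s,g)\mapsto s^g$ of $G(X)$. For an $X$-set $S$ and $m\ge 1$, $C^Q_m(X)_S$ is the free abelian group on $U^Q_m(X)_S=\{(s;a_1,\dots,a_m)\in S\times X^m\mid a_i\ne a_{i+1}\ (1\le i\le m-1)\}$, and $C^Q_0(X)_S$ is the free abelian group on $S$. Define homomorphisms $f,g:C^Q_m(X)_S\to C^Q_{m-1}(X)_S$ by $f(s;a_1,\dots,a_m)=\sum_{i=1}^m(-1)^i(s;a_1,\dots,a_{i-1},a_{i+1},\dots,a_m)$ and $g(s;a_1,\dots,a_m)=\sum_{i=1}^m(-1)^{i+1}(s^{a_i};a_1^{a_i},\dots,a_{i-1}^{a_i},a_{i+1},\dots,a_m)$, where terms having two equal consecutive colors $b_j=b_{j+1}$ are removed (read as $0$). Then $\partial=f+g$ satisfies $\partial\circ\partial=0$; cycles and boundaries of $(X,S)$ are with respect to $\partial$. The length $l(\gamma)$ of a non-zero chain $\gamma=\sum_u n_u u$ (written in the basis $U^Q_m(X)_S$) is $\sum_u|n_u|$.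 When $S=\{o\}$ is a single point with trivial action we write $C^Q_m(X)$ and $(a_1,\dots,a_m)$ for $(o;a_1,\dots,a_m)$; an $m$-cocycle of $X$ with coefficients in an abelian group $A$ is a homomorphism $\theta: C^Q_m(X)\to A$ with $\theta\circ\partial=0$. Let $\pi:C^Q_m(X)_S\to C^Q_m(X)$, $\pi(s;a_1,\dots,a_m)=(a_1,\dots,a_m)$. For an $m$-cocycle $\theta$ of $X$ put $l(\theta,S)=\min\{l(\gamma)\mid \gamma \text{ is an } m\text{-cycle of }(X,S)\text{ with }\theta(\pi(\gamma))\ne0\}$ (and $l(\theta,S)=0$ if this set is empty), and $l(\theta)=\max\{l(\theta,S)\mid S\text{ an }X\text{-set}\}$ (and $l(\theta)=\infty$ if the set is unbounded). $l(\theta)$ is called the length of $\theta$. The octahedral quandle is $O_6=\{0,1,2,3,4,5\}$, the set of vertices of a regular octahedron in which $\{0,3\}$, $\{1,4\}$, $\{2,5\}$ are the pairs of opposite vertices; $a^b$ is the image of $a$ under the $\pi/2$-rotation about the axis through $b$ and the center (counterclockwise seen from $b$). Explicitly, $x\mapsto x^b$ is the 4-cycle: for $b=0$: $1\to2\to4\to5\to1$; $b=3$: $1\to5\to4\to2\to1$; $b=1$: $0\to5\to3\to2\to0$; $b=4$: $0\to2\to3\to5\to0$; $b=2$: $0\to1\to3\to4\to0$; $b=5$: $0\to4\to3\to1\to0$ (the two remaining elements are fixed). Let $r:O_6\to O_6$, $r(x)=x^0$, which has order four. The 3-cocycle $\eta:C^Q_3(O_6)\to\mathbb{Z}/3\mathbb{Z}$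 is defined on generators by: $\eta(a,b,c)=1$ if $(a,b,c)=(r^k(a'),r^k(b'),r^k(c'))$ for some $k\in\{0,1,2,3\}$ and some $(a',b',c')\in\{(0,1,2),(0,3,1),(1,2,0),(1,4,2),(3,1,5)\}$; $\eta(a,b,c)=2$ if $(a,b,c)=(r^k(a'),r^k(b'),r^k(c'))$ for some $k\in\{0,1,2,3\}$ and some $(a',b',c')\in\{(0,1,5),(1,0,1),(1,0,5),(1,2,1),(1,3,1),(1,3,2),(1,4,5),(1,5,1),(3,0,1),(3,1,0),(3,1,2)\}$; and $\eta(a,b,c)=0$ otherwise. *)

(* Defs.v *)
From HB Require Import structures.
From mathcomp Require Import all_boot all_order all_algebra.
From mathcomp Require Import generic_quotient.
From mathcomp Require Import boolp constructive_ereal.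
From mathcomp Require Import freeg.

Set Implicit Arguments.
Unset Strict Implicit.
Unset Printing Implicit Defensive.

Import Order.TTheory GRing.Theory Num.Theory.
Local Open Scope ring_scope.
Local Open Scope quotient_scope.

(* Carriers of quandles and of X-sets are choiceTypes: under the axioms of
   boolp every type carries such a structure, so this is no restriction. *)

HB.mixin Record isQuandle X of Choice X := {
  qop : X -> X -> X;
  qinhab : inhabited X;
  qidem : forall a, qop a a = a;
  qbij : forall y, bijective (qop^~ y);
  qdist : forall a b c, qop (qop a b) c = qop (qop a c) (qop b c)
}.

#[short(type="quandleType")]
HB.structure Definition Quandle := { X of isQuandle X & Choice X }.

(* a ◁ b is the operation written a^b in exponential notation. *)
Notation "a ◁ b" := (qop a b) (at level 40, left associativity) : ring_scope.

Section AssociatedGroup.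
Variable X : quandleType.

(* The letter (false, a) stands for the generator a, (true, a) for a^-1. *)
Definition assoc_word : Type := seq (bool * X).
HB.instance Definition _ := Choice.on assoc_word.

Inductive assoc_eqv : assoc_word -> assoc_word -> Prop :=
| assoc_refl w : assoc_eqv w w
| assoc_sym v w : assoc_eqv v w -> assoc_eqv w v
| assoc_trans u v w : assoc_eqv u v -> assoc_eqv v w -> assoc_eqv u w
| assoc_cat v v' w w' :
    assoc_eqv v v' -> assoc_eqv w w' -> assoc_eqv (v ++ w) (v' ++ w')
| assoc_cancel e a : assoc_eqv [:: (e, a); (~~ e, a)] [::]
| assoc_relator a b :
    assoc_eqv [:: (true, b); (false, a); (false, b); (true, a ◁ b)] [::].

Definition assoc_eqvb (v w : assoc_word) : bool := `[< assoc_eqv v w >].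

Lemma assoc_eqvb_refl : reflexive assoc_eqvb.
Proof. by move=> w; apply/asboolP; apply: assoc_refl. Qed.

Lemma assoc_eqvb_sym : symmetric assoc_eqvb.
Proof. by move=> v w; apply/asboolP/asboolP; apply: assoc_sym. Qed.

Lemma assoc_eqvb_trans : transitive assoc_eqvb.
Proof.
by move=> v u w /asboolP uv /asboolP vw; apply/asboolP; apply: assoc_trans vw.
Qed.

Canonical assoc_equiv :=
  EquivRel assoc_eqvb assoc_eqvb_refl assoc_eqvb_sym assoc_eqvb_trans.

Definition assoc_group : Type := {eq_quot assoc_equiv}.
HB.instance Definition _ := Choice.on assoc_group.

Definition assoc_cls (w : assoc_word) : assoc_group := \pi_({eq_quot assoc_equiv}) w.
Definition assoc_repr (g : assoc_group) : assoc_word :=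
  repr (g : {eq_quot assoc_equiv}).

Definition assoc_inv_word (w : assoc_word) : assoc_word :=
  rev [seq (~~ l.1, l.2) | l <- w].

Definition assoc_one : assoc_group := assoc_cls [::].
Definition assoc_mul (g h : assoc_group) : assoc_group :=
  assoc_cls (assoc_repr g ++ assoc_repr h).
Definition assoc_inv (g : assoc_group) : assoc_group :=
  assoc_cls (assoc_inv_word (assoc_repr g)).

Lemma assoc_clsP v w : assoc_cls v = assoc_cls w <-> assoc_eqv v w.
Proof. by split=> [/eqmodP/asboolP|h]; last by apply/eqmodP/asboolP. Qed.

Lemma assoc_reprK g : assoc_cls (assoc_repr g) = g.
Proof. exact: reprK. Qed.

Lemma assoc_repr_cls w : assoc_eqv (assoc_repr (assoc_cls w)) w.
Proof. by apply/assoc_clsP; rewrite assoc_reprK. Qed.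

Lemma assoc_mul_cls v w :
  assoc_mul (assoc_cls v) (assoc_cls w) = assoc_cls (v ++ w).
Proof. by apply/assoc_clsP/assoc_cat; apply: assoc_repr_cls. Qed.

Lemma assoc_mulA : associative assoc_mul.
Proof.
move=> g h k; rewrite -(assoc_reprK g) -(assoc_reprK h) -(assoc_reprK k).
by rewrite !assoc_mul_cls catA.
Qed.

Lemma assoc_mul1g : left_id assoc_one assoc_mul.
Proof. by move=> g; rewrite -(assoc_reprK g) assoc_mul_cls. Qed.

Lemma assoc_mulg1 : right_id assoc_one assoc_mul.
Proof. by move=> g; rewrite -(assoc_reprK g) assoc_mul_cls cats0. Qed.

Lemma assoc_inv_wordK : involutive assoc_inv_word.
Proof.
move=> w; rewrite /assoc_inv_word map_rev revK -map_comp -[RHS]map_id.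
by apply: eq_map => -[e a] /=; rewrite negbK.
Qed.

Lemma assoc_word_mulV w : assoc_eqv (w ++ assoc_inv_word w) [::].
Proof.
elim: w => [|[e a] w IHw]; first exact: assoc_refl.
rewrite /assoc_inv_word /= rev_cons -cats1 -cat_cons catA.
rewrite -(cat1s (e, a) w) -catA -/(assoc_inv_word w).
apply: assoc_trans (assoc_cancel e a).
rewrite -(cat1s (e, a) [:: (~~ e, a)]) -catA.
apply: assoc_cat; first exact: assoc_refl.
by rewrite catA -[X in assoc_eqv _ X]cat0s; apply: assoc_cat IHw (assoc_refl _).
Qed.

Lemma assoc_mulgV : right_inverse assoc_one assoc_inv assoc_mul.
Proof.
move=> g; rewrite -{1}(assoc_reprK g) assoc_mul_cls.
exact/assoc_clsP/assoc_word_mulV.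
Qed.

Lemma assoc_mulVg : left_inverse assoc_one assoc_inv assoc_mul.
Proof.
move=> g; rewrite -{2}(assoc_reprK g) assoc_mul_cls; apply/assoc_clsP.
by rewrite -{2}(assoc_inv_wordK (assoc_repr g)); apply: assoc_word_mulV.
Qed.

HB.instance Definition _ := isGroup.Build assoc_group
  assoc_mulA assoc_mul1g assoc_mulg1 assoc_mulVg assoc_mulgV.

Definition assoc_gen (a : X) : assoc_group := assoc_cls [:: (false, a)].

Record xset := XSet {
  xset_car :> choiceType;
  xact : xset_car -> assoc_group -> xset_car;
  xact1 : forall s, xact s 1%g = s;
  xactM : forall s g h, xact s (g * h)%g = xact (xact s g) h
}.

Definition xset_point : xset :=
  @XSet unit (fun s _ => s) (fun _ => erefl) (fun _ _ _ => erefl).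

End AssociatedGroup.

Section LinearExtension.
Variables (K : choiceType) (V : zmodType).

Definition lin_ext (h : K -> V) (c : {freeg K}) : V :=
  fglift (h : K -> zmodule V) c.

Lemma lin_ext_is_additive h : zmod_morphism (lin_ext h).
Proof. exact: (lift_is_additive (h : K -> zmodule V)). Qed.

HB.instance Definition _ h :=
  GRing.isZmodMorphism.Build {freeg K} V (lin_ext h) (lin_ext_is_additive h).

Lemma lin_extE h c : lin_ext h c = \sum_(u <- dom c) h u *~ coeff u c.
Proof.
rewrite -{1}(freeg_sumE c) raddf_sum; apply: eq_bigr => u _.
by rewrite /= /lin_ext (liftU (h : K -> zmodule V)) scalezrE.
Qed.

Lemma lin_extU h u : lin_ext h << u >> = h u.
Proof. by rewrite /lin_ext (liftU (h : K -> zmodule V)) scale1r. Qed.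

Lemma freeg_additive0 (phi : {additive {freeg K} -> V}) :
  (forall u, phi << u >> = 0) -> forall c, phi c = 0.
Proof.
move=> phi0 c; rewrite -(freeg_sumE c) raddf_sum big1 // => u _.
by rewrite -[coeff u c]intz -freegU_mulz raddfMz phi0 mul0rz.
Qed.

End LinearExtension.

Section Chains.
Variable X : quandleType.

Definition nondegenerate m (a : m.-tuple X) : bool :=
  sorted (fun x y => x != y) a.

(* For m = 0 there is only the empty tuple of colors, so that chain S 0 is
   the free abelian group on S. *)
Definition chain_gen (S : xset X) (m : nat) : Type :=
  {u : S * m.-tuple X | nondegenerate u.2}.
HB.instance Definition _ S m := Choice.on (chain_gen S m).

Definition chain (S : xset X) (m : nat) : Type := {freeg chain_gen S m}.
HB.instance Definition _ S m := GRing.Zmodule.on (chain S m).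

Definition term (S : xset X) m (s : S) (a : m.-tuple X) : chain S m :=
  if insub (s, a) is Some u then << (u : chain_gen S m) >> else 0.

Definition face_colors m (a : m.+1.-tuple X) (i : 'I_m.+1) : m.-tuple X :=
  [tuple tnth a (fintype.lift i j) | j < m].

Definition acted_face_colors m (a : m.+1.-tuple X) (i : 'I_m.+1) : m.-tuple X :=
  [tuple if (fintype.lift i j < i)%N then tnth a (fintype.lift i j) ◁ tnth a i
         else tnth a (fintype.lift i j) | j < m].

(* Indices start from 0 here, which shifts the signs by one. *)
Definition bd_f (S : xset X) m : chain S m.+1 -> chain S m :=
  lin_ext (fun u : chain_gen S m.+1 =>
    let: (s, a) := val u in
    \sum_(i < m.+1) term s (face_colors a i) *~ (-1) ^+ i.+1).

Definition bd_g (S : xset X) m : chain S m.+1 -> chain S m :=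
  lin_ext (fun u : chain_gen S m.+1 =>
    let: (s, a) := val u in
    \sum_(i < m.+1)
      term (xact s (assoc_gen (tnth a i))) (acted_face_colors a i) *~ (-1) ^+ i).

Definition boundary (S : xset X) m (c : chain S m.+1) : chain S m :=
  bd_f c + bd_g c.

Lemma boundary_is_additive S m : zmod_morphism (@boundary S m).
Proof.
move=> c d; rewrite /boundary /bd_f /bd_g.
by rewrite (lin_ext_is_additive _ c d) (lin_ext_is_additive _ c d) opprD addrACA.
Qed.

HB.instance Definition _ S m := GRing.isZmodMorphism.Build
  (chain S m.+1) (chain S m) (@boundary S m) (@boundary_is_additive S m).

Lemma boundaryU S m (u : chain_gen S m.+1) :
  boundary << u >> =
    \sum_(i < m.+1) (term (val u).1 (face_colors (val u).2 i) *~ (-1) ^+ i.+1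
      + term (xact (val u).1 (assoc_gen (tnth (val u).2 i)))
             (acted_face_colors (val u).2 i) *~ (-1) ^+ i).
Proof.
rewrite /boundary /bd_f /bd_g !lin_extU big_split /=.
by case: u => -[s a].
Qed.

Definition chain_length (S : xset X) m (c : chain S m) : nat :=
  (\sum_(u <- dom c) `|coeff u c|)%N.

Definition chain_proj (S : xset X) m : chain S m -> chain (xset_point X) m :=
  lin_ext (fun u : chain_gen S m =>
    term (tt : xset_point X) (val u).2).

Record cocycle (m : nat) (A : zmodType) := Cocycle {
  cocycle_fun :> {additive chain (xset_point X) m -> A};
  cocycleP : forall c : chain (xset_point X) m.+1, cocycle_fun (boundary c) = 0
}.

(* n is the length of an (m+1)-cycle of (X, S) that theta detects; such a cycle
   is automatically non-zero. *)
Definition detected_length m A (theta : cocycle m.+1 A) (S : xset X) (n : nat) :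
    Prop :=
  exists c : chain S m.+1,
    [/\ boundary c = 0, theta (chain_proj c) != 0 & chain_length c = n].

Definition length_at m A (theta : cocycle m.+1 A) (S : xset X) : nat :=
  match pselect (exists n, `[< detected_length theta S n >]) with
  | left h => ex_minn h
  | right _ => 0%N
  end.

Definition length_value m A (theta : cocycle m.+1 A) (n : nat) : Prop :=
  exists S : xset X, length_at theta S = n.

Lemma length_value_inhab m A (theta : cocycle m.+1 A) :
  exists n, `[< length_value theta n >].
Proof.
by exists (length_at theta (xset_point X)); apply/asboolP; exists (xset_point X).
Qed.

Definition cocycle_length m A (theta : cocycle m.+1 A) : \bar nat :=
  match pselect (exists b, forall n, `[< length_value theta n >] -> (n <= b)%N) with
  | left h => ((ex_maxn (length_value_inhab theta) (projT2 (cid h)))%:E)%E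
  | right _ => +oo%E
  end.

End Chains.

Definition O6 : Type := 'I_6.
HB.instance Definition _ := Finite.on O6.

Local Notation "` k" := (@Ordinal 6 k isT : O6) (at level 0, k at level 0).

(* O6_cycle b is the 4-cycle by which b acts; next fixes the elements that do
   not occur in it. *)
Definition O6_cycle (b : O6) : seq O6 :=
  nth [::]
    [:: [:: `1; `2; `4; `5];
        [:: `0; `5; `3; `2];
        [:: `0; `1; `3; `4];
        [:: `1; `5; `4; `2];
        [:: `0; `2; `3; `5];
        [:: `0; `4; `3; `1]] b.

Definition O6_op (a b : O6) : O6 := next (O6_cycle b) a.

Definition O6_enum : seq O6 := [:: `0; `1; `2; `3; `4; `5].

Lemma mem_O6_enum (a : O6) : a \in O6_enum.
Proof. by case: a => -[|[|[|[|[|[|]]]]]]. Qed.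

Lemma O6_all1 (P : pred O6) : all P O6_enum -> forall a, P a.
Proof. by move=> /allP h a; apply/h/mem_O6_enum. Qed.

Lemma O6_opaa a : O6_op a a = a.
Proof. by apply/eqP; move: a; apply: O6_all1; vm_compute. Qed.

Lemma O6_op_bij b : bijective (O6_op^~ b).
Proof.
have uniq_cycle : uniq (O6_cycle b) by move: b; apply: O6_all1; vm_compute.
by exists (prev (O6_cycle b)) => a; [apply: prev_next | apply: next_prev].
Qed.

Lemma O6_op_dist a b c : O6_op (O6_op a b) c = O6_op (O6_op a c) (O6_op b c).
Proof.
apply/eqP; move: c; apply: O6_all1; move: b; apply: O6_all1.
by move: a; apply: O6_all1; vm_compute.
Qed.

HB.instance Definition _ := isQuandle.Build O6
  (inhabits `0) O6_opaa O6_op_bij O6_op_dist.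

Definition O6_r (x : O6) : O6 := x ◁ `0.

Definition r_orbits (ps : seq (seq O6)) : seq (seq O6) :=
  [seq map (iter k O6_r) p | k <- [:: 0; 1; 2; 3]%N, p <- ps].

Definition eta_one : seq (seq O6) :=
  [:: [:: `0; `1; `2]; [:: `0; `3; `1]; [:: `1; `2; `0]; [:: `1; `4; `2];
      [:: `3; `1; `5]].

Definition eta_two : seq (seq O6) :=
  [:: [:: `0; `1; `5]; [:: `1; `0; `1]; [:: `1; `0; `5]; [:: `1; `2; `1];
      [:: `1; `3; `1]; [:: `1; `3; `2]; [:: `1; `4; `5]; [:: `1; `5; `1];
      [:: `3; `0; `1]; [:: `3; `1; `0]; [:: `3; `1; `2]].

Definition eta_val (t : seq O6) : 'Z_3 :=
  if t \in r_orbits eta_one then 1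
  else if t \in r_orbits eta_two then 2 else 0.

Definition eta_fun : chain (xset_point O6) 3 -> 'Z_3 :=
  lin_ext (fun u : chain_gen (xset_point O6) 3 => eta_val (val u).2).

HB.instance Definition _ := GRing.isZmodMorphism.Build
  (chain (xset_point O6) 3) 'Z_3 eta_fun (lin_ext_is_additive _).

Lemma eta_val_degenerate (t : 3.-tuple O6) : ~~ nondegenerate t -> eta_val t = 0.
Proof.
move=> degt; rewrite /eta_val.
have nd ps : all (sorted (fun x y : O6 => x != y)) (r_orbits ps) ->
    (t : seq O6) \in r_orbits ps = false.
  by move=> /allP h; apply: contraNF degt => /h.
by rewrite !nd //; vm_compute.
Qed.

Lemma eta_fun_term (s : xset_point O6) (t : 3.-tuple O6) :
  eta_fun (term s t) = eta_val t.
Proof.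
rewrite /term; case: insubP => [u _ uE|degt].
  by rewrite /eta_fun lin_extU uE.
by rewrite raddf0 eta_val_degenerate.
Qed.

Lemma eta_fun_boundary (c : chain (xset_point O6) 4) : eta_fun (boundary c) = 0.
Proof.
have cval x y z w :
    nondegenerate [tuple x; y; z; w] ->
    - eta_val [:: y; z; w] + eta_val [:: y; z; w]
    + eta_val [:: x; z; w] - eta_val [:: x ◁ y; z; w]
    - eta_val [:: x; y; w] + eta_val [:: x ◁ z; y ◁ z; w]
    + eta_val [:: x; y; z] - eta_val [:: x ◁ w; y ◁ w; z ◁ w] == 0.
  move=> nd; apply/implyP: nd.
  move: w; apply: O6_all1; move: z; apply: O6_all1.
  by move: y; apply: O6_all1; move: x; apply: O6_all1; vm_compute.
apply: (freeg_additive0 (phi := eta_fun \o @boundary _ _ 3)) => -[[s t] nd] /=.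
move: nd; case/tupleP: t => x t; case/tupleP: t => y t; case/tupleP: t => z t.
case/tupleP: t => w t; rewrite (tuple0 t) {t} => nd.
rewrite boundaryU raddf_sum !big_ord_recl big_ord0 /=.
rewrite !raddfD /= !raddfMz /= !eta_fun_term /=.
rewrite !enum_ordSl !enum_ord0 /= !(tnth_nth x) /=.
rewrite /bump /= !expr0 !exprS !expr0 !mulr1 !mulrNN !mulr1 !mulrN1z !mulr1z addr0.
by rewrite !addrA; apply/eqP/cval.
Qed.

Definition eta : cocycle O6 3 'Z_3 := Cocycle eta_fun_boundary.

(* Main.v *)
From HB Require Import structures.
From mathcomp Require Import all_boot all_order all_algebra.
From mathcomp Require Import boolp constructive_ereal.
From mathcomp Require Import freeg.
From mathcomp Require Import zify ring.
Require Import Defs.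

Set Implicit Arguments.
Unset Strict Implicit.
Unset Printing Implicit Defensive.

Import Order.TTheory GRing.Theory Num.Theory.
Local Open Scope ring_scope.

(** Why the length is eight.

    Upper bound.  Over any label s, the difference of (a, b, a) and (b, a, b) for
    neighbouring vertices a, b has a boundary of the form F(s.a, a) - F(s.b, a^b)
    with b fixed ([boundary_cap]).  Let a run through the equator 0, 5, 3, 2 of the
    axis through b = 1 and choose the labels so that the end of each piece is the
    beginning of the next.  The sum of the four pieces closes up because the fourth
    powers of all generators of the associated group coincide ([label_cycle]): each
    is central, since four quarter turns are the identity, and generators are
    conjugate.  The cocycle takes the value -4 = 2 modulo 3 on this cycle of length
    at most eight, so every non-empty set of labels detects the cocycle at length
    at most eight.

    Lower bound.  It remains to find one set of labels over which no cycle of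
    length at most seven is detected.  The product of the integers, where each
    generator adds 1, with the 24 positions (frames) of the octahedron has this
    property.  A cycle of length n is a list of n signed labelled triples whose
    signed faces cancel, so it is found by search: among the faces not yet
    cancelled choose one, and some further triple of the cycle must contain its
    opposite.  There are at most 36 such triples, and a residue of more than 6k
    faces cannot be cancelled by k triples ([search_sound]).  Cycles are considered
    up to translation of the degree, up to the symmetries of the set of frames, and
    up to rotation of labels and colors; the last changes neither the length nor,
    by the cocycle condition, the value ([eta_sum_rotate]).  Hence the search may
    start at degree 0, at the standard frame, and at one of seven triples
    ([search_reps]); an induction on the length disposes of cycles that contain a
    shorter one. *)

(** * Actions of the associated group *)

Section GeneratedAction.
Variables (X : quandleType) (T : choiceType) (act actV : T -> X -> T).
Hypothesis actK : forall a, cancel (act^~ a) (actV^~ a).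
Hypothesis actVK : forall a, cancel (actV^~ a) (act^~ a).
Hypothesis act_dist : forall s a b, act (act s b) (a ◁ b) = act (act s a) b.

Definition word_act (s : T) (w : assoc_word X) : T :=
  foldl (fun s (l : bool * X) => if l.1 then actV s l.2 else act s l.2) s w.

(** Invertibility of each generator absorbs the cancellation rule, and the
    single exchange law [act_dist] absorbs the defining relators, so a family of
    permutations indexed by the quandle is all that an X-set requires. *)
Lemma word_act_eqv v w : assoc_eqv v w -> forall s, word_act s v = word_act s w.
Proof.
elim=> {v w}
  [//|v w _ IH s|u v w _ IH1 _ IH2 s|v v' w w' _ IH1 _ IH2 s|[] a s|a b s].
- by rewrite IH.
- by rewrite IH1.
- by rewrite /word_act !foldl_cat -!/(word_act _ _) IH1.
- exact: actVK.
- exact: actK.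
- by rewrite /word_act /= -act_dist actVK actK.
Qed.

Definition generated_act (s : T) (g : assoc_group X) : T :=
  word_act s (assoc_repr g).

Lemma generated_act1 s : generated_act s 1%g = s.
Proof. exact: (word_act_eqv (assoc_repr_cls [::])). Qed.

Lemma generated_actM s g h :
  generated_act s (g * h)%g = generated_act (generated_act s g) h.
Proof.
rewrite /generated_act (word_act_eqv (assoc_repr_cls _)).
exact: foldl_cat.
Qed.

Definition generated_xset : xset X := XSet generated_act1 generated_actM.

Lemma generated_actE (s : T) a :
  @xact X generated_xset s (assoc_gen a) = act s a.
Proof. exact: (word_act_eqv (assoc_repr_cls [:: (false, a)])). Qed.

End GeneratedAction.

Section Chains.
Variable X : quandleType.

Lemma assoc_gen_conj (a b : X) :
  assoc_gen (a ◁ b) = (assoc_gen a ^ assoc_gen b)%g.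
Proof.
have clsM (v w : assoc_word X) : (assoc_cls v * assoc_cls w)%g = assoc_cls (v ++ w).
  exact: assoc_mul_cls.
have gen_inv (c : X) : ((assoc_gen c)^-1 = assoc_cls [:: (true, c)])%g.
  apply: (@mulgI _ (assoc_gen c)); rewrite mulgV /assoc_gen clsM.
  by apply/esym/assoc_clsP; apply: assoc_cancel.
rewrite conjgE mulgA.
apply: (@mulIg _ (assoc_gen (a ◁ b))^-1%g); rewrite mulgV !gen_inv /assoc_gen.
rewrite (clsM [:: (true, b)] [:: (false, a)]).
rewrite (clsM _ [:: (false, b)]) (clsM _ [:: (true, a ◁ b)]).
by apply/esym/assoc_clsP; apply: assoc_relator.
Qed.

(** * Chains and their length *)

Lemma term_generator (S : xset X) m (u : chain_gen S m) :
  term (val u).1 (val u).2 = << u >>.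
Proof. by rewrite /term -surjective_pairing valK. Qed.

Lemma term_degenerate (S : xset X) m (s : S) (a : m.-tuple X) :
  ~~ nondegenerate a -> term s a = 0.
Proof. by rewrite /term => nd; case: insubP => // u /= ; rewrite (negPf nd). Qed.

HB.instance Definition _ (S : xset X) m := GRing.isZmodMorphism.Build
  (chain S m) (chain (xset_point X) m) (@chain_proj X S m)
  (lin_ext_is_additive _).

Lemma chain_proj_term (S : xset X) m (s : S) (a : m.-tuple X) :
  chain_proj (term s a) = term (tt : xset_point X) a.
Proof.
rewrite {1}/term; case: insubP => [u _ uE|nd].
  by rewrite /chain_proj lin_extU uE.
by rewrite raddf0 term_degenerate.
Qed.

Lemma boundary_term3 (S : xset X) (s : S) a b c : a != b -> b != c ->
  boundary (term s [tuple a; b; c]) =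
    - term s [tuple b; c] + term s [tuple a; c] - term s [tuple a; b]
    + (term (xact s (assoc_gen a)) [tuple b; c]
       - term (xact s (assoc_gen b)) [tuple a ◁ b; c]
       + term (xact s (assoc_gen c)) [tuple a ◁ c; b ◁ c]).
Proof.
move=> ab bc; have nd : nondegenerate [tuple a; b; c].
  by rewrite /nondegenerate /= ab bc.
rewrite {1}/term insubT boundaryU /= !big_ord_recl big_ord0.
have face2 (p q : 2.-tuple X) : p = q :> seq X -> p = q by exact: val_inj.
pose i1 : 'I_3 := fintype.lift ord0 ord0.
pose i2 : 'I_3 := fintype.lift ord0 (fintype.lift ord0 ord0).
have ->: face_colors [tuple a; b; c] ord0 = [tuple b; c].
  by apply: face2; rewrite /= !enum_ordSl enum_ord0 /= !(tnth_nth a).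
have ->: face_colors [tuple a; b; c] i1 = [tuple a; c].
  by apply: face2; rewrite /= !enum_ordSl enum_ord0 /= !(tnth_nth a).
have ->: face_colors [tuple a; b; c] i2 = [tuple a; b].
  by apply: face2; rewrite /= !enum_ordSl enum_ord0 /= !(tnth_nth a).
have ->: acted_face_colors [tuple a; b; c] ord0 = [tuple b; c].
  by apply: face2; rewrite /= !enum_ordSl enum_ord0 /= !(tnth_nth a).
have ->: acted_face_colors [tuple a; b; c] i1 = [tuple a ◁ b; c].
  by apply: face2; rewrite /= !enum_ordSl enum_ord0 /= !(tnth_nth a).
have ->: acted_face_colors [tuple a; b; c] i2 = [tuple a ◁ c; b ◁ c].
  by apply: face2; rewrite /= !enum_ordSl enum_ord0 /= !(tnth_nth a).
rewrite /bump /= !exprS !expr0 !mulr1 !mulN1r !opprK !mulrNz !mulr1z addr0.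
by rewrite [LHS](AC (2*(2*2)) ((1*3*5)*(2*4*6))).
Qed.

(** A chain of length n is an honest list of n signed generators; this is what
    turns a bound on the length into a bound on a search depth. *)
Lemma chain_signed_sum (S : xset X) m (c : chain S m) :
  exists2 r : seq (bool * chain_gen S m), size r = chain_length c &
    c = \sum_(p <- r) << p.2 >> *~ (-1) ^+ p.1.
Proof.
exists (flatten [seq nseq `|coeff u c| (coeff u c < 0, u) | u <- dom c]).
  rewrite size_flatten sumnE /shape -map_comp big_map /chain_length.
  by apply: eq_bigr => u _; rewrite /= size_nseq.
rewrite big_flatten /= big_map -[LHS]freeg_sumE; apply: eq_bigr => u _.
rewrite big_nseq iter_addr_0 /= pmulrn -mulrzA freegU_mulz.
by rewrite abszE -intEsign intz.
Qed.

Lemma chain_lengthE (S : xset X) m (c : chain S m) (r : seq (chain_gen S m)) :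
  uniq r -> {subset dom c <= r} ->
  chain_length c = (\sum_(u <- r) `|coeff u c|)%N.
Proof.
move=> ur cr; rewrite (bigID (mem (dom c))) /= [X in (_ + X)%N]big1 ?addn0.
  rewrite -big_filter; apply: perm_big; apply: uniq_perm => [||u].
  - exact: uniq_dom.
  - exact: filter_uniq.
  by rewrite mem_filter; case: (boolP (u \in dom c)) => // /cr->.
by move=> u /coeff_outdom->.
Qed.

Lemma chain_lengthD (S : xset X) m (c d : chain S m) :
  (chain_length (c + d)%R <= chain_length c + chain_length d)%N.
Proof.
pose r := undup (dom c ++ dom d).
have ur : uniq r by exact: undup_uniq.
rewrite (chain_lengthE ur (c := c)); last first.
  by move=> u uc; rewrite mem_undup mem_cat uc.
rewrite (chain_lengthE ur (c := d)); last first.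
  by move=> u ud; rewrite mem_undup mem_cat ud orbT.
rewrite (chain_lengthE ur (c := (c + d))); last first.
  by move=> u /domD_subset; rewrite mem_undup.
by rewrite -big_split /=; apply: leq_sum => u _; rewrite coeffD; lia.
Qed.

Lemma chain_lengthN (S : xset X) m (c : chain S m) :
  chain_length (- c) = chain_length c.
Proof.
rewrite (chain_lengthE (uniq_dom c)) => [|u]; last by rewrite domN.
by apply: eq_bigr => u _; rewrite coeffN abszN.
Qed.

Lemma chain_length_term (S : xset X) m (s : S) (a : m.-tuple X) :
  (chain_length (term s a) <= 1)%N.
Proof.
rewrite /term /chain_length; case: insubP => [u _ _|_].
  by rewrite domU1 big_seq1 coeffU eqxx.
by rewrite dom0 big_nil.
Qed.

End Chains.

(** * A detected cycle of length eight over every non-empty set *)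

Section Fans.
Variables (X : quandleType) (S : xset X).

Definition cap (s : S) (a b : X) : chain S 3 :=
  term s [tuple a; b; a] - term s [tuple b; a; b].

(** The boundary of a cap consists of three faces at each of two labels.  They are
    written relative to an axis b so that both ends have the same shape, which is
    what makes sums of caps about b telescope. *)
Definition fan (s : S) (b a : X) : chain S 2 :=
  term s [tuple b; a] + term s [tuple a; b ◁ a] + term s [tuple b ◁ a; b].

(** The faces at s cancel, being the same for (a, b, a) and (b, a, b).  The faces
    at s.b form a fan around b only because b ◁ (a ◁ b) = a, a law of
    neighbouring vertices of the octahedron that amounts to the braid relation. *)
Lemma boundary_cap (s : S) a b : a != b -> b ◁ (a ◁ b) = a ->
  boundary (cap s a b) =
    fan (xact s (assoc_gen a)) b a - fan (xact s (assoc_gen b)) b (a ◁ b).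
Proof.
move=> ab bab; have ba : b != a by rewrite eq_sym.
have loop (u : S) x : term u [tuple x; x] = 0.
  by apply: term_degenerate; rewrite /nondegenerate /= eqxx.
rewrite raddfB /= !boundary_term3 // /fan bab !qidem !loop.
rewrite !addr0 !opprD !opprK.
set A := term s [tuple a; b]; set B := term s [tuple b; a].
rewrite [LHS](AC ((2*3)*(2*3)) (((1*7)*(2*6))*((3*5*9)*(10*4*8)))).
by rewrite /= !addNr !add0r.
Qed.

End Fans.

(** With x_k = x ^ (p ^ k), each factor p * x_k^-1 equals
    p^-(k-1) * x^-1 * p^k; the product telescopes to x^-3 * p^4. *)
Lemma conj_telescope (G : groupType) (x p : G) : (x ^+ 4 = p ^+ 4)%g ->
  (p * (x ^ p)^-1 * (p * (x ^ (p ^+ 2))^-1) * (p * (x ^ (p ^+ 3))^-1) * p = x)%g.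
Proof.
move=> xp; transitivity (x^-1 * x^-1 * x^-1 * p ^+ 4)%g; last first.
  by rewrite -xp !expgS expg0 mulg1 !mulgA mulgVK mulgVK mulVg mul1g.
rewrite !expgS !expg0 !mulg1 -!conjVg !conjgE !invgM !mulgA.
by rewrite !(mulgV, mulVg, mulgK, mulgVK, mul1g).
Qed.

(** Four quarter turns about b are the identity on the octahedron, so the fourth
    power of b commutes with every generator. *)
Lemma assoc_gen_pow4_central (a b : O6) :
  commute (assoc_gen a) (assoc_gen b ^+ 4)%g.
Proof.
apply/commgP; rewrite -conjg_fix; apply/eqP.
rewrite !expgS expg0 mulg1 !conjgM -!assoc_gen_conj; congr assoc_gen.
by apply/eqP; move: b; apply: O6_all1; move: a; apply: O6_all1; vm_compute.
Qed.

(** Conjugate generators have conjugate fourth powers, and these are central. *)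
Lemma assoc_gen_pow4 (a b c : O6) : a ◁ b = c ->
  (assoc_gen a ^+ 4 = assoc_gen c ^+ 4)%g.
Proof.
move=> <-; rewrite assoc_gen_conj -conjXg; apply/esym/eqP.
by rewrite conjg_fix; apply/commgP/commute_sym/assoc_gen_pow4_central.
Qed.

Local Notation "` k" := (@Ordinal 6 k isT : O6) (at level 0, k at level 0).

Section EightCycle.
Variables (S : xset O6) (s : S).

(** The label from which the generator a leads to the same place as the generator
    1 leads from t: the end of one cap is then the start of the next. *)
Definition next_label (t : S) (a : O6) : S :=
  xact t (assoc_gen `1 * (assoc_gen a)^-1)%g.

Definition label1 := next_label s `5.
Definition label2 := next_label label1 `3.
Definition label3 := next_label label2 `2.

Lemma next_labelE t a : xact (next_label t a) (assoc_gen a) = xact t (assoc_gen `1).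
Proof. by rewrite -xactM mulgVK. Qed.

(** After a full turn about the vertex 1 the chain of caps closes up, because the
    generators 0 and 1 have the same fourth power in the associated group. *)
Lemma label_cycle : xact label3 (assoc_gen `1) = xact s (assoc_gen `0).
Proof.
rewrite -!xactM !mulgA; congr (xact s _).
have pow4 : (assoc_gen `0 ^+ 4 = assoc_gen `1 ^+ 4)%g.
  by apply: (@assoc_gen_pow4 _ `2); apply/eqP; vm_compute.
rewrite -[RHS](conj_telescope pow4) !mulgA.
rewrite !expgS expg0 mulg1 !conjgM -!assoc_gen_conj.
have -> : `0 ◁ `1 = `5 by apply/eqP; vm_compute.
have -> : `5 ◁ `1 = `3 by apply/eqP; vm_compute.
by have -> : `3 ◁ `1 = `2 by apply/eqP; vm_compute.
Qed.

(** One cap of two generators for each quarter turn about the vertex 1. *)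
Definition eight_cycle : chain S 3 :=
  cap s `0 `1 + cap label1 `5 `1 + cap label2 `3 `1 + cap label3 `2 `1.

Lemma boundary_eight_cycle : boundary eight_cycle = 0.
Proof.
have capE (t : S) (a b : O6) : [&& a != `1, `1 ◁ b == a & a ◁ `1 == b] ->
    boundary (cap t a `1) =
    fan (xact t (assoc_gen a)) `1 a - fan (xact t (assoc_gen `1)) `1 b.
  by case/and3P=> a1 /eqP ba /eqP ab; rewrite boundary_cap ?ab.
have cap0 := capE s `0 `5 isT.
have cap1 := capE label1 `5 `3 isT.
have cap2 := capE label2 `3 `2 isT.
have cap3 := capE label3 `2 `0 isT.
rewrite /eight_cycle 3!raddfD /= {}cap0 {}cap1 {}cap2 {}cap3.
rewrite label_cycle /label3 next_labelE -/label3.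
rewrite /label2 next_labelE -/label2 /label1 next_labelE -/label1.
by do 4!move: (fan _ _ _) => ?; rewrite !subrKA subrr.
Qed.

Lemma chain_length_eight_cycle : (chain_length eight_cycle <= 8)%N.
Proof.
have cap2 (t : S) a b : (chain_length (cap t a b) <= 2)%N.
  apply: leq_trans (chain_lengthD _ _) _; rewrite chain_lengthN.
  by apply: (@leq_add _ _ 1 1); apply: chain_length_term.
have addD (c : chain S 3) n t a b : (chain_length c <= n)%N ->
    (chain_length (c + cap t a b)%R <= n + 2)%N.
  by move=> cn; apply: leq_trans (chain_lengthD _ _) (leq_add cn _).
by apply: (addD _ 6); apply: (addD _ 4); apply: (addD _ 2).
Qed.

Lemma eta_eight_cycle : eta (chain_proj eight_cycle) != 0.
Proof.
have eta_cap (t : S) (a b : O6) : eta (chain_proj (cap t a b)) =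
    eta_val [:: a; b; a] - eta_val [:: b; a; b].
  by rewrite !raddfB /= !chain_proj_term !eta_fun_term.
(* (x, 1, x) has value 0, 2, 0, 2 for x = 0, 5, 3, 2, and (1, x, 1) has value 2:
   the sum is -4. *)
rewrite /eight_cycle 3!raddfD 3!raddfD /= !eta_cap.
by vm_compute.
Qed.

End EightCycle.

Lemma detected_eight (S : xset O6) (s : S) :
  exists2 n, (n <= 8)%N & detected_length eta S n.
Proof.
exists (chain_length (eight_cycle s)); first exact: chain_length_eight_cycle.
exists (eight_cycle s); split=> //; first exact: boundary_eight_cycle.
exact: eta_eight_cycle.
Qed.

(** If some cycle is detected, the set is not empty, and then it carries the cycle
    of length eight. *)
Lemma length_at_le8 (S : xset O6) : (length_at eta S <= 8)%N.
Proof.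
rewrite /length_at; case: pselect => // detS.
case: ex_minnP => n /asboolP[c [_ eta_c _]] nmin.
have [s _] : exists s : S, True.
  case: (dom c) (freeg_sumE c) => [c0|u r _]; last by exists (val u).1.
  by move: eta_c; rewrite -c0 big_nil !raddf0 eqxx.
have [k k8 det] := detected_eight s.
by apply: leq_trans k8; apply/nmin/asboolP.
Qed.

(** * A finite model of the octahedron *)

(** A copy of the octahedral quandle as an enumerated type: the search below is
    evaluated inside the kernel, and pattern matching on constructors is far
    cheaper there than arithmetic on bounded integers. *)
Inductive vertex := V0 | V1 | V2 | V3 | V4 | V5.

Definition vcode v : nat :=
  match v with V0 => 0 | V1 => 1 | V2 => 2 | V3 => 3 | V4 => 4 | V5 => 5 end.

Definition vertices := [:: V0; V1; V2; V3; V4; V5].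

Lemma vcodeK : cancel vcode (nth V0 vertices).
Proof. by case. Qed.

Definition vertex_eqb (a b : vertex) : bool :=
  match a, b with
  | V0, V0 | V1, V1 | V2, V2 | V3, V3 | V4, V4 | V5, V5 => true
  | _, _ => false
  end.

Lemma vertex_eqbP : Equality.axiom vertex_eqb.
Proof. by case; case; constructor. Qed.

HB.instance Definition _ := hasDecEq.Build vertex vertex_eqbP.
HB.instance Definition _ := CanIsCountable vcodeK.

Lemma vertexP (P : pred vertex) : all P vertices -> forall a, P a.
Proof. by move=> /= /and5P[? ? ? ? /and3P[]] ? ? _; case. Qed.

Definition opp v :=
  match v with V0 => V3 | V1 => V4 | V2 => V5 | V3 => V0 | V4 => V1 | V5 => V2 end.

Definition rot (a b : vertex) : vertex :=
  match b with
  | V0 => match a with V1 => V2 | V2 => V4 | V4 => V5 | V5 => V1 | _ => a end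
  | V1 => match a with V0 => V5 | V5 => V3 | V3 => V2 | V2 => V0 | _ => a end
  | V2 => match a with V0 => V1 | V1 => V3 | V3 => V4 | V4 => V0 | _ => a end
  | V3 => match a with V1 => V5 | V5 => V4 | V4 => V2 | V2 => V1 | _ => a end
  | V4 => match a with V0 => V2 | V2 => V3 | V3 => V5 | V5 => V0 | _ => a end
  | V5 => match a with V0 => V4 | V4 => V3 | V3 => V1 | V1 => V0 | _ => a end
  end.

Lemma rotK a b : rot (rot a b) (opp b) = a.
Proof. by case: a; case: b. Qed.

Lemma rotKV a b : rot (rot a (opp b)) b = a.
Proof. by case: a; case: b. Qed.

Lemma rot_inj b : injective (rot^~ b).
Proof. exact: (can_inj (g := rot^~ (opp b)) (rotK^~ b)). Qed.

Lemma rotD a b c : rot (rot a b) c = rot (rot a c) (rot b c).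
Proof. by case: a; case: b; case: c. Qed.

Lemma rot_opp a b : rot (opp a) b = opp (rot a b).
Proof. by case: a; case: b. Qed.

(** Evaluated once and for all, since each call of [eta_val] runs through the
    rotated lists. *)
Definition eta_table : seq (seq (seq nat)) := Eval vm_compute in
  [seq [seq [seq nat_of_ord (eta_val [:: a; b; c]) | c <- O6_enum]
    | b <- O6_enum] | a <- O6_enum].

Definition eta_nat (a b c : vertex) : nat :=
  nth 0%N (nth [::] (nth [::] eta_table (vcode a)) (vcode b)) (vcode c).

(** * Signed triples and their signed faces *)

(** A label consists of a degree d and of an ordered pair (u, v) of vertices that
    are neither equal nor opposite.  Such a pair determines the rotation taking
    (V0, V1) to it, so labels are elements of the product of the integers with the
    rotation group, the degrees being translated so as to be natural numbers.
    The sign [true] is the negative one. *)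
Record sface := SFace {
  fneg : bool; fdeg : nat; fu : vertex; fv : vertex; fx : vertex; fy : vertex }.

Record sterm := STerm {
  tneg : bool; tdeg : nat; tu : vertex; tv : vertex;
  ta : vertex; tb : vertex; tc : vertex }.

(** Nested conditionals, because an evaluator that works by value would compare all
    the fields in a conjunction. *)
Definition sface_eqb (f g : sface) : bool :=
  let: SFace e d u v x y := f in let: SFace e' d' u' v' x' y' := g in
  if vertex_eqb x x' then if vertex_eqb y y' then if vertex_eqb u u' then
  if vertex_eqb v v' then if eqb e e' then eqn d d'
  else false else false else false else false else false.

Lemma vertex_eqb_refl a : vertex_eqb a a.
Proof. exact/vertex_eqbP. Qed.

Lemma sface_eqbP : Equality.axiom sface_eqb.
Proof.
case=> e d u v x y [e' d' u' v' x' y']; apply: (iffP idP) => /=.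
  by do 4!case: vertex_eqbP => // ->; case: e e' => -[] //= /eqP->.
by case=> -> -> -> -> -> ->; rewrite !vertex_eqb_refl eqnE eqxx; case: (e').
Qed.
HB.instance Definition _ := hasDecEq.Build sface sface_eqbP.

Definition sterm_eqb (t w : sterm) : bool :=
  let: STerm e d u v a b c := t in let: STerm e' d' u' v' a' b' c' := w in
  if vertex_eqb a a' then if vertex_eqb b b' then if vertex_eqb c c' then
  if vertex_eqb u u' then if vertex_eqb v v' then if eqb e e' then eqn d d'
  else false else false else false else false else false else false.

Lemma sterm_eqbP : Equality.axiom sterm_eqb.
Proof.
case=> e d u v a b c [e' d' u' v' a' b' c']; apply: (iffP idP) => /=.
  by do 5!case: vertex_eqbP => // ->; case: e e' => -[] //= /eqP->.
by case=> -> -> -> -> -> -> ->; rewrite !vertex_eqb_refl eqnE eqxx; case: (e').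
Qed.
HB.instance Definition _ := hasDecEq.Build sterm sterm_eqbP.

Definition oppf f := let: SFace e d u v x y := f in SFace (~~ e) d u v x y.
Definition oppt t := let: STerm e d u v a b c := t in STerm (~~ e) d u v a b c.

(** Faces with two equal colors vanish. *)
Definition cons_face e d u v x y l :=
  if vertex_eqb x y then l else SFace e d u v x y :: l.

Definition faces (t : sterm) : seq sface :=
  let: STerm e d u v a b c := t in
  cons_face (~~ e) d u v b c (cons_face e d u v a c
  (cons_face (~~ e) d u v a b
  (cons_face e d.+1 (rot u a) (rot v a) b c
  (cons_face (~~ e) d.+1 (rot u b) (rot v b) (rot a b) c
  (cons_face e d.+1 (rot u c) (rot v c) (rot a c) (rot b c) [::]))))).

(** Cancelling at once keeps residues free of opposite pairs, without which the
    number of faces in a residue would say nothing about how many triples are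
    needed to cancel it. *)
Fixpoint add_face f l :=
  if l is g :: l' then if sface_eqb (oppf f) g then l' else g :: add_face f l'
  else [:: f].

Definition add_faces t l := foldr add_face l (faces t).

Definition cons_term e d u v a b c l :=
  if vertex_eqb a b || vertex_eqb b c then l else STerm e d u v a b c :: l.

(** The signed triples having f among their faces, z being the deleted color: in
    the first three f is a face at the label of the triple, in the last three it
    is reached through z, whose inverse is the rotation about the opposite vertex.
    The latter lie one degree below f, and degrees are kept non-negative. *)
Definition candidates_at (f : sface) (z : vertex) : seq sterm :=
  let: SFace e d u v x y := f in
  cons_term (~~ e) d u v z x y (cons_term e d u v x z y
  (cons_term (~~ e) d u v x y z
  (if d is d'.+1 then
    let z' := opp z in
    let u' := rot u z' in let v' := rot v z' in let x' := rot x z' in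
    cons_term e d' u' v' z x y (cons_term (~~ e) d' u' v' x' z y
    (cons_term e d' u' v' x' (rot y z') z [::]))
  else [::]))).

Definition candidates f := flatten [seq candidates_at f z | z <- vertices].

(** Faces of lowest degree are treated first: a face of degree 0 can only be a
    face at the label of a triple, which halves the number of candidates. *)
Definition lower_face f g := if (fdeg g < fdeg f)%N then g else f.

(** A representative of the value on L in natural numbers; as -1 = 2 modulo 3, a
    negative triple contributes twice its value. *)
Definition eta_total (L : seq sterm) : nat :=
  foldr (fun t n => let: STerm e _ _ _ a b c := t in
    (if e then 2 * eta_nat a b c + n else eta_nat a b c + n)%N) 0%N L.

(** Depth-first search over the ways of completing L to a cycle with at most n
    further triples, res being the uncancelled faces of L; it succeeds if every
    completion that is found has value 0.  Some triple still to come must cancel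
    the chosen face g.  Two kinds of branches are cut: a triple opposite to one
    of L leaves a shorter cycle of the same value, and a residue of more than 6n
    faces cannot be cancelled by n triples. *)
Fixpoint search (n : nat) (L : seq sterm) (res : seq sface) : bool :=
  if res is f :: r then
    if n is n'.+1 then
      let g := foldl lower_face f r in
      all (fun t =>
        if has (sterm_eqb (oppt t)) L then true else
        let res' := add_faces t res in
        if (6 * n' < size res')%N then true else search n' (t :: L) res')
      (candidates (oppf g))
    else true
  else (3 %| eta_total L)%N.

(** One triple from each of the seven classes under rotation. *)
Definition orbit_reps : seq (vertex * vertex * vertex) :=
  [:: (V0, V1, V3); (V0, V1, V2); (V0, V1, V5); (V0, V1, V0); (V0, V1, V4);
      (V0, V3, V1); (V0, V3, V0)].

Definition start (t : vertex * vertex * vertex) : sterm :=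
  STerm false 0 V0 V1 t.1.1 t.1.2 t.2.

(** * Balanced lists of faces *)

Section Weights.
Variable h : nat -> vertex -> vertex -> vertex -> vertex -> int.

Definition face_weight f : int :=
  let: SFace e d u v x y := f in (-1) ^+ e * h d u v x y.

Definition weight F : int := \sum_(f <- F) face_weight f.

Lemma face_weight_opp f : face_weight (oppf f) = - face_weight f.
Proof. by case: f => -[] d u v x y /=; rewrite ?mul1r ?mulN1r ?opprK. Qed.

Lemma weight_cat F1 F2 : weight (F1 ++ F2) = weight F1 + weight F2.
Proof. exact: big_cat. Qed.

Lemma weight_cons f F : weight (f :: F) = face_weight f + weight F.
Proof. exact: big_cons. Qed.

Lemma weight_perm F1 F2 : perm_eq F1 F2 -> weight F1 = weight F2.
Proof. exact: perm_big. Qed.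

Lemma weight_opp F : weight (map oppf F) = - weight F.
Proof.
rewrite /weight big_map -sumrN; apply: eq_bigr => f _.
exact: face_weight_opp.
Qed.

Lemma weight_add_face f l : weight (add_face f l) = face_weight f + weight l.
Proof.
elim: l => [|g l IHl] /=; first by rewrite weight_cons.
case: sface_eqbP => [<-|_]; last by rewrite !weight_cons IHl addrCA.
by rewrite weight_cons face_weight_opp addrA subrr add0r.
Qed.

Lemma weight_add_faces t l : weight (add_faces t l) = weight (faces t) + weight l.
Proof.
rewrite /add_faces; elim: (faces t) => [|f F IHF] /=.
  by rewrite /weight big_nil add0r.
by rewrite weight_add_face IHF weight_cons addrA.
Qed.

End Weights.

Definition boundary_faces R := flatten (map faces R).

(** The faces cancel in the free abelian group on unsigned faces.  Testing against
    all integral weights makes relabellings harmless even where they are not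
    injective, since weights can be pulled back. *)
Definition balanced F := forall h, weight h F = 0.

Lemma oppfK : involutive oppf.
Proof. by case=> e d u v x y; rewrite /= negbK. Qed.

Lemma boundary_faces_cat R1 R2 :
  boundary_faces (R1 ++ R2) = boundary_faces R1 ++ boundary_faces R2.
Proof. by rewrite /boundary_faces map_cat flatten_cat. Qed.

Lemma boundary_faces_perm R1 R2 :
  perm_eq R1 R2 -> perm_eq (boundary_faces R1) (boundary_faces R2).
Proof. by move=> R12; apply/perm_flatten/perm_map. Qed.

Lemma balanced_perm F1 F2 : perm_eq F1 F2 -> balanced F1 -> balanced F2.
Proof. by move=> F12 b1 h; rewrite -(weight_perm h F12). Qed.

(** The witness is the indicator of the unsigned face under f, with the sign of f:
    without an opposite face its sum would be positive. *)
Lemma balanced_mem F f : balanced F -> f \in F -> oppf f \in F.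
Proof.
move=> bF fF; apply: contraT => nF.
pose k (g : sface) := let: SFace _ d u v x y := g in (d, u, v, x, y).
pose h d u v x y : int := ((d, u, v, x, y) == k f)%:R.
have wE g : g \in F -> (-1) ^+ fneg f * face_weight h g = (k g == k f)%:R.
  move=> gF; have {nF gF}: g != oppf f by apply: contraNneq nF => <-.
  case: g f @h {bF fF} => e d u v x y [e' d' u' v' x' y'] /=.
  have [[-> -> -> -> ->]|_] := (d, u, v, x, y) =P (d', u', v', x', y').
    by case: e e' => -[]; rewrite ?eqxx //= ?mulr1 ?mulN1r ?opprK.
  by rewrite !mulr0.
have: (-1) ^+ fneg f * weight h F = 0 by rewrite bF mulr0.
rewrite /weight mulr_sumr (eq_big_seq _ wE) (big_rem _ fF) /= eqxx.
move/eqP; rewrite addrC paddr_eq0 ?oner_eq0 ?andbF //.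
by apply: sumr_ge0 => g _; rewrite ler0n.
Qed.

Definition cancellation_free (F : seq sface) := forall f, f \in F -> oppf f \notin F.

(** Each face of F1 has its opposite in F2, with multiplicity; this justifies
    cutting branches with too large a residue. *)
Lemma cancellation_free_size F1 F2 : cancellation_free F1 -> balanced (F1 ++ F2) ->
  (size F1 <= size F2)%N.
Proof.
elim: F1 F2 => [|f F1 IHF] // F2 redF bal.
have fF2 : oppf f \in F2.
  have /(balanced_mem bal) : f \in (f :: F1) ++ F2 by rewrite mem_head.
  by rewrite mem_cat (negPf (redF _ (mem_head _ _))).
have sz := size_rem fF2; have F2_gt0 : (0 < size F2)%N by case: (F2) fF2.
rewrite /= -(prednK F2_gt0) -sz ltnS; apply: IHF => [g gF|h].
  by have /redF : g \in f :: F1 by [rewrite inE gF orbT]; rewrite inE => /norP[].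
have := bal h; rewrite !weight_cat weight_cons.
rewrite (weight_perm h (perm_to_rem fF2)) weight_cons face_weight_opp => <-.
by rewrite addrACA subrr add0r.
Qed.

Lemma mem_add_face f g l : g \in add_face f l -> g = f \/ g \in l.
Proof.
elim: l => [|k l IHl] /=; first by rewrite inE => /eqP->; left.
case: ifP => _; rewrite !inE; first by move=> ->; right; rewrite orbT.
case/orP=> [->|/IHl[->|->]]; [by right | by left | by right; rewrite orbT].
Qed.

Lemma cancellation_free_behead f l :
  cancellation_free (f :: l) -> cancellation_free l.
Proof.
move=> red g gl; have /red : g \in f :: l by rewrite inE gl orbT.
by rewrite inE => /norP[].
Qed.

Lemma oppf_neq f : oppf f != f.
Proof. by apply/eqP; case: f => -[]. Qed.

Lemma cancellation_free_cons f l :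
  oppf f \notin l -> cancellation_free l -> cancellation_free (f :: l).
Proof.
move=> nf red g; rewrite !inE => /orP[/eqP->|gl]; rewrite negb_or.
  by rewrite oppf_neq.
rewrite (red _ gl) andbT; apply: contraNneq nf => fE.
by rewrite -fE oppfK.
Qed.

Lemma cancellation_free_add_face f l :
  cancellation_free l -> cancellation_free (add_face f l).
Proof.
elim: l => [|g l IHl] red /=; first exact: cancellation_free_cons.
case: sface_eqbP => [_|nfg]; first exact: cancellation_free_behead red.
apply: cancellation_free_cons; last exact/IHl/(cancellation_free_behead red).
apply/negP=> /mem_add_face[fE|gl]; first by apply: nfg; rewrite -fE oppfK.
have := red g (mem_head _ _); by rewrite inE gl orbT.
Qed.

Lemma cancellation_free_add_faces t l :
  cancellation_free l -> cancellation_free (add_faces t l).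
Proof.
rewrite /add_faces => red; elim: (faces t) => //= f F.
exact: cancellation_free_add_face.
Qed.

Lemma cons_face_size e d u v x y l :
  (size (cons_face e d u v x y l) <= (size l).+1)%N.
Proof. by rewrite /cons_face; case: vertex_eqb => //=; apply: leqnSn. Qed.

Lemma size_faces t : (size (faces t) <= 6)%N.
Proof.
by case: t => e d u v a b c; rewrite /faces;
  do 6![apply: leq_trans (cons_face_size _ _ _ _ _ _ _) _; rewrite ltnS].
Qed.

Lemma size_boundary_faces R : (size (boundary_faces R) <= 6 * size R)%N.
Proof.
elim: R => //= t R IHR; rewrite /boundary_faces /= size_cat mulnS.
exact: leq_add (size_faces t) IHR.
Qed.

Definition nondeg t := (ta t != tb t) && (tb t != tc t).

Lemma mem_cons_face f e d u v x y l :
  f \in cons_face e d u v x y l -> f = SFace e d u v x y \/ f \in l.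
Proof.
by rewrite /cons_face; case: ifP => _; [right | rewrite inE => /predU1P].
Qed.

Lemma cons_term_head e d u v a b c l : a != b -> b != c ->
  STerm e d u v a b c \in cons_term e d u v a b c l.
Proof.
rewrite /cons_term => /negPf ab /negPf bc.
by rewrite -[vertex_eqb a b]/(a == b) -[vertex_eqb b c]/(b == c) ab bc mem_head.
Qed.

Lemma cons_term_tail t e d u v a b c l : t \in l -> t \in cons_term e d u v a b c l.
Proof. by rewrite /cons_term; case: ifP => // _ tl; rewrite inE tl orbT. Qed.

Lemma map_cons_face e d u v x y l :
  map oppf (cons_face e d u v x y l) = cons_face (~~ e) d u v x y (map oppf l).
Proof. by rewrite /cons_face; case: ifP. Qed.

Lemma faces_opp t : faces (oppt t) = map oppf (faces t).
Proof. by case: t => e d u v a b c; rewrite /faces /= !map_cons_face. Qed.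

Lemma candidates_complete f t : nondeg t -> f \in faces t -> t \in candidates f.
Proof.
case: t => e d u v a b c; rewrite /nondeg /= => /andP[ab bc] ft.
suff [z tz] : exists z, STerm e d u v a b c \in candidates_at f z.
  apply/flatten_mapP; exists z => //.
  by move: z {tz}; apply: vertexP.
case/mem_cons_face: ft => [->|/mem_cons_face[->|/mem_cons_face[->|
  /mem_cons_face[->|/mem_cons_face[->|/mem_cons_face[->|//]]]]]];
  rewrite /candidates_at.
- by exists a; rewrite negbK; apply: cons_term_head.
- by exists b; apply: cons_term_tail; apply: cons_term_head.
- by exists c; rewrite negbK; do 2!apply: cons_term_tail; apply: cons_term_head.
- by exists a; rewrite !rotK; do 3!apply: cons_term_tail; apply: cons_term_head.
- exists b; rewrite negbK !rotK; do 4!apply: cons_term_tail.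
  exact: cons_term_head.
- by exists c; rewrite !rotK; do 5!apply: cons_term_tail; apply: cons_term_head.
Qed.

Lemma mem_foldl_lower f r : foldl lower_face f r \in f :: r.
Proof.
elim: r f => [|g r IHr] f /=; first exact: mem_head.
have := IHr (lower_face f g); rewrite !inE => /orP[/eqP->|->]; last by rewrite !orbT.
by rewrite /lower_face; case: ifP; rewrite eqxx ?orbT.
Qed.

Definition eta_term t : 'Z_3 :=
  (-1) ^+ tneg t * (eta_nat (ta t) (tb t) (tc t))%:R.

Definition eta_sum R := \sum_(t <- R) eta_term t.

Lemma eta_sum_perm R1 R2 : perm_eq R1 R2 -> eta_sum R1 = eta_sum R2.
Proof. exact: perm_big. Qed.

Lemma eta_term_opp t : eta_term (oppt t) = - eta_term t.
Proof.
by case: t => -[] d u v a b c; rewrite /eta_term /= ?mul1r ?mulN1r ?opprK.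
Qed.

Lemma eta_sum_total R : eta_sum R = (eta_total R)%:R.
Proof.
elim: R => [|t R IHR]; first by rewrite /eta_sum big_nil.
rewrite /eta_sum big_cons -/(eta_sum R) IHR.
case: t => -[] d u v a b c; rewrite /eta_term /= natrD ?mul1r // natrM.
by congr (_ * _ + _); apply/eqP.
Qed.

Lemma nat3_eq0 n : (3 %| n)%N -> n%:R = 0 :> 'Z_3.
Proof.
move=> /dvdnP[k ->]; rewrite natrM (_ : 3%:R = 0 :> 'Z_3) ?mulr0 //.
exact/eqP.
Qed.

Lemma eta_sum0 R : (3 %| eta_total R)%N -> eta_sum R = 0.
Proof. by rewrite eta_sum_total => /nat3_eq0. Qed.

Definition frame_label (u v : vertex) := (v != u) && (v != opp u).
Definition admissible t := nondeg t && frame_label (tu t) (tv t).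

(** Taken as an induction hypothesis on the number of triples. *)
Definition null_upto N := forall R, (size R < N)%N -> all admissible R ->
  balanced (boundary_faces R) -> eta_sum R = 0.

(** * Soundness of the search *)

(** A triple of R cancels the chosen face, hence is among the candidates.  Either
    its opposite lies in L, and deleting both gives a shorter cycle with the same
    value, or the search went on with this triple moved from R to L. *)
Lemma search_sound n L res R :
  cancellation_free res -> (forall h, weight h res = weight h (boundary_faces L)) ->
  (0 < size L)%N -> all admissible L -> (size R <= n)%N -> all admissible R ->
  balanced (boundary_faces (L ++ R)) -> null_upto (size (L ++ R)) ->
  search n L res -> eta_sum (L ++ R) = 0.
Proof.
elim: n L res R => [|n IHn] L res R red resL L_gt0 admL szR admR bal null.
- have R0 : R = [::] by apply/nilP; rewrite /nilp -leqn0.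
  case: res red resL => [|f r] red resL /=.
    by rewrite R0 cats0; apply: eta_sum0.
  have bal0 : balanced (f :: r).
    by move=> h; rewrite resL; move: (bal h); rewrite R0 cats0.
  have := balanced_mem bal0 (mem_head f r).
  by rewrite (negPf (red _ (mem_head f r))).
case: res red resL => [|f r] red resL.
  move=> /= /eta_sum0 etaL; rewrite /eta_sum big_cat /= -/(eta_sum L) etaL add0r.
  apply: null => //; first by rewrite size_cat -addn1 addnC leq_add2r.
  move=> h; have := bal h; rewrite boundary_faces_cat weight_cat -resL.
  by rewrite {1}/weight big_nil add0r.
set res := f :: r in red resL *; set g := foldl lower_face f r.
have gres : g \in res by exact: mem_foldl_lower.
have bal' : balanced (res ++ boundary_faces R).
  by move=> h; rewrite weight_cat resL -weight_cat -boundary_faces_cat.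
have /flatten_mapP[t tR gt] : oppf g \in boundary_faces R.
  have /(balanced_mem bal') : g \in res ++ boundary_faces R by rewrite mem_cat gres.
  by rewrite mem_cat (negPf (red _ gres)).
have admt : admissible t by have /allP := admR; apply.
have /andP[ndt _] := admt.
rewrite [search _ _ _]/= -/g => /allP /(_ t (candidates_complete ndt gt)).
have permR := perm_to_rem tR.
have permLR : perm_eq (L ++ R) ((t :: L) ++ rem t R).
  by rewrite (perm_trans (perm_cat (perm_refl L) permR)) // -[t :: rem t R]cat1s
    catA perm_cat2r cats1 perm_rcons.
have admR' : all admissible (rem t R).
  by apply/allP=> w /mem_rem; have /allP := admR; apply.
case: hasP => [[w wL /sterm_eqbP wE] _|_].
  have permL := perm_to_rem wL.
  have permLR' : perm_eq (L ++ R) (t :: oppt t :: rem w L ++ rem t R).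
    rewrite (perm_trans permLR) //= perm_cons wE.
    by rewrite -cat_cons perm_cat2r.
  rewrite (eta_sum_perm permLR') /eta_sum !big_cons eta_term_opp addrA subrr add0r.
  apply: null.
  - by rewrite (perm_size permLR') /= ltnW.
  - rewrite all_cat admR' andbT; apply/allP=> x /mem_rem.
    by have /allP := admL; apply.
  move=> h; have := bal h.
  rewrite (weight_perm h (boundary_faces_perm permLR')).
  rewrite {1}/boundary_faces /= !weight_cat addrA.
  suff -> : weight h (faces (oppt t)) = - weight h (faces t).
    by rewrite subrr add0r.
  by rewrite faces_opp weight_opp.
have weight' h : weight h (add_faces t res) = weight h (boundary_faces (t :: L)).
  by rewrite weight_add_faces resL -weight_cat.
have szR' : (size (rem t R) <= n)%N.
  by rewrite size_rem // -ltnS (leq_trans _ szR) //; case: (R) tR.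
case: ltnP => [big_res _|_ srch].
  suff : (size (add_faces t res) <= 6 * n)%N by rewrite leqNgt big_res.
  apply: leq_trans (leq_trans (size_boundary_faces (rem t R)) _); last first.
    by rewrite leq_mul2l.
  apply: cancellation_free_size; first exact: cancellation_free_add_faces.
  move=> h; rewrite weight_cat weight' -weight_cat -boundary_faces_cat.
  by rewrite -(weight_perm h (boundary_faces_perm permLR)).
rewrite (eta_sum_perm permLR); apply: (IHn _ (add_faces t res)) => //.
- exact: cancellation_free_add_faces.
- by rewrite /= admt.
- by apply: balanced_perm bal; apply: boundary_faces_perm.
- by move: null; rewrite (perm_size permLR).
Qed.

(** * Symmetries of cycles *)

Section Relabelling.
Variables (D : nat -> nat) (U V : vertex -> vertex -> vertex) (P : vertex -> vertex).

Definition map_term t :=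
  let: STerm e d u v a b c := t in
  STerm e (D d) (U u v) (V u v) (P a) (P b) (P c).

Definition map_face f :=
  let: SFace e d u v x y := f in SFace e (D d) (U u v) (V u v) (P x) (P y).

Hypothesis P_inj : injective P.
Hypothesis P_rot : forall a b, P (rot a b) = rot (P a) (P b).
Hypothesis U_rot : forall u v a, U (rot u a) (rot v a) = rot (U u v) (P a).
Hypothesis V_rot : forall u v a, V (rot u a) (rot v a) = rot (V u v) (P a).

Lemma map_face_cons e d u v x y l : map map_face (cons_face e d u v x y l) =
  cons_face e (D d) (U u v) (V u v) (P x) (P y) (map map_face l).
Proof.
rewrite /cons_face -[vertex_eqb x y]/(x == y) -(inj_eq P_inj).
by rewrite -[vertex_eqb (P x) (P y)]/(P x == P y); case: ifP.
Qed.

Lemma faces_map_term t : D (tdeg t).+1 = (D (tdeg t)).+1 ->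
  faces (map_term t) = map map_face (faces t).
Proof.
case: t => e d u v a b c /= DS; rewrite !map_face_cons /= DS.
by rewrite !P_rot !U_rot !V_rot.
Qed.

Lemma balanced_map R : {in R, forall t, D (tdeg t).+1 = (D (tdeg t)).+1} ->
  balanced (boundary_faces R) -> balanced (boundary_faces (map map_term R)).
Proof.
move=> DS bal h.
have -> : boundary_faces (map map_term R) = map map_face (boundary_faces R).
  rewrite /boundary_faces map_flatten -!map_comp; congr flatten.
  by apply/eq_in_map=> t tR; apply/faces_map_term/DS.
apply: etrans (bal (fun d u v x y => h (D d) (U u v) (V u v) (P x) (P y))).
by rewrite /weight big_map; apply: eq_bigr => -[].
Qed.

Lemma nondeg_map t : nondeg (map_term t) = nondeg t.
Proof. by case: t => e d u v a b c; rewrite /nondeg /= !(inj_eq P_inj). Qed.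

End Relabelling.

(** The three symmetries used to normalize one triple of a cycle: translation of
    degrees, simultaneous rotation of labels and colors, and the translation of the
    rotation group, commuting with the action on labels, by the rotation that
    takes (V0, V1) to (i, j). *)
Definition shift m := map_term (subn^~ m) (fun u _ => u) (fun _ v => v) id.

Definition rotate x :=
  map_term id (fun u _ => rot u x) (fun _ v => rot v x) (rot^~ x).

(** The image of the vertex k under the rotation taking (V0, V1) to (u, v). *)
Definition frame_image (u v k : vertex) :=
  match k with
  | V0 => u | V1 => v | V2 => rot v u
  | V3 => opp u | V4 => opp v | V5 => opp (rot v u)
  end.

Definition reframe i j :=
  map_term id (fun u v => frame_image u v i) (fun u v => frame_image u v j) id.

Lemma frame_image_rot u v k a :
  frame_image (rot u a) (rot v a) k = rot (frame_image u v k) a.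
Proof. by case: k => /=; rewrite ?rot_opp // [rot (rot v u) a]rotD. Qed.

Lemma frame_label_image u v i j : frame_label u v -> frame_label i j ->
  frame_label (frame_image u v i) (frame_image u v j).
Proof. by case: u; case: v => //= _; case: i; case: j. Qed.

Lemma frame_image_onto u v : frame_label u v ->
  exists i j, [/\ frame_label i j, frame_image u v i = V0 & frame_image u v j = V1].
Proof.
have onto : all (fun u => all (fun v => frame_label u v ==>
    has (fun i => has (fun j => [&& frame_label i j, frame_image u v i == V0 &
      frame_image u v j == V1]) vertices) vertices) vertices) vertices.
  by vm_compute.
move: onto => /vertexP/(_ u)/vertexP/(_ v)/implyP h /h.
case/hasP=> i _ /hasP[j _ /and3P[ij /eqP ui /eqP vj]].
by exists i, j.
Qed.

Lemma frame_label_rot u v x : frame_label (rot u x) (rot v x) = frame_label u v.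
Proof. by case: u; case: v; case: x. Qed.

(** The cocycle condition on (a, b, c, x), expressing the change of the value
    under rotation by x through the faces of (a, b, c); minus signs are written
    as factors 2. *)
Lemma eta_nat_rot a b c x :
  (3 %| eta_nat a b c + 2 * eta_nat (rot a x) (rot b x) (rot c x)
    + (2 * eta_nat b c x + eta_nat a c x + 2 * eta_nat a b x
    + eta_nat b c x + 2 * eta_nat (rot a b) c x + eta_nat (rot a c) (rot b c) x))%N.
Proof.
move: x; apply: vertexP; move: c; apply: vertexP.
by move: b; apply: vertexP; move: a; apply: vertexP; vm_compute.
Qed.

(** Rotation by x is homotopic to the identity: the difference of the two values
    is a sum over the faces weighted by the value of (_, _, x), which is 0 on a
    balanced list. *)
Lemma eta_sum_rotate x R : balanced (boundary_faces R) ->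
  eta_sum (map (rotate x) R) = eta_sum R.
Proof.
move=> bal; pose h (_ : nat) (_ _ a b : vertex) : int := eta_nat a b x.
pose w f : 'Z_3 := (face_weight h f)%:~R.
have w_sum F : \sum_(f <- F) w f = (weight h F)%:~R by rewrite /weight rmorph_sum.
have degen a : eta_nat a a x = 0%N by case: a @h @w w_sum; case: x.
have w_cons e d u v a b l : \sum_(f <- cons_face e d u v a b l) w f =
    (-1) ^+ e * (eta_nat a b x)%:R + \sum_(f <- l) w f.
  rewrite /cons_face; case: vertex_eqbP => [->|_].
    by rewrite degen mulr0 add0r.
  by rewrite big_cons /w /= rmorphM rmorph_sign /= /h pmulrn.
have termE t : eta_term (rotate x t) - eta_term t = \sum_(f <- faces t) w f.
  case: t => e d u v a b c; rewrite /= !w_cons big_nil addr0 /eta_term /=.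
  have /nat3_eq0 := eta_nat_rot a b c x; rewrite !(natrM, natrD).
  have -> : 2%:R = -1 :> 'Z_3 by exact/eqP.
  rewrite signrN; move: ((-1) ^+ e) => s.
  do 7!move: (eta_nat _ _ _)%:R => ?.
  move=> e0; apply/eqP; rewrite -subr_eq0 -oppr_eq0.
  rewrite -[X in _ == X](mulr0 s) -[in X in _ == X]e0.
  by apply/eqP; ring.
rewrite /eta_sum big_map; apply/eqP; rewrite -subr_eq0 -sumrB; apply/eqP.
rewrite (eq_bigr _ (fun t _ => termE t)).
rewrite -(big_map faces xpredT (fun F => \sum_(f <- F) w f)) -big_flatten.
by rewrite w_sum bal.
Qed.

Definition cyclic R := all admissible R /\ balanced (boundary_faces R).

(** Every short cycle through t has value 0, granted the same for shorter cycles.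
    Being settled is pulled back along the symmetries, so that it has to be
    checked by search for seven triples only. *)
Definition settled t := forall R, t \in R -> (size R < 8)%N -> cyclic R ->
  null_upto (size R) -> eta_sum R = 0.

Lemma settled_transport (T : sterm -> sterm) t :
  (forall R, t \in R -> cyclic R ->
    cyclic (map T R) /\ (eta_sum (map T R) = 0 -> eta_sum R = 0)) ->
  settled (T t) -> settled t.
Proof.
move=> TR st R tR szR cR null; have [cTR] := TR R tR cR; apply.
by apply: st; rewrite ?size_map // map_f.
Qed.

Lemma cyclic_map D U V P R :
  injective P -> (forall a b, P (rot a b) = rot (P a) (P b)) ->
  (forall u v a, U (rot u a) (rot v a) = rot (U u v) (P a)) ->
  (forall u v a, V (rot u a) (rot v a) = rot (V u v) (P a)) ->
  (forall u v, frame_label u v -> frame_label (U u v) (V u v)) ->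
  {in R, forall t, D (tdeg t).+1 = (D (tdeg t)).+1} ->
  cyclic R -> cyclic (map (map_term D U V P) R).
Proof.
move=> Pi PR UR VR UV DS [adm bal]; split; last exact: balanced_map.
apply/allP=> _ /mapP[t tR ->]; have /allP/(_ t tR)/andP[nd fl] := adm.
by rewrite /admissible nondeg_map // nd; case: (t) fl => e d u v a b c /= /UV.
Qed.

Lemma eta_sum_map D U V R : eta_sum (map (map_term D U V id) R) = eta_sum R.
Proof. by rewrite /eta_sum big_map; apply: eq_bigr => -[]. Qed.

Lemma search_reps :
  all (fun t => search 6 [:: start t] (add_faces (start t) [::])) orbit_reps.
Proof. by vm_compute. Qed.

Lemma settled_start t : t \in orbit_reps -> settled (start t).
Proof.
move=> trep R tR szR [adm bal] null.
have permR := perm_to_rem tR.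
rewrite (eta_sum_perm permR) -cat1s.
(* A cycle of length at most 7 has at most 6 triples besides t. *)
apply: (search_sound (n := 6) (res := add_faces (start t) [::])) => //.
- by apply: cancellation_free_add_faces.
- move=> h; rewrite weight_add_faces /boundary_faces /= cats0.
  by rewrite [weight h [::]]big_nil addr0.
- by move: t trep {tR permR}; apply/allP; vm_compute.
- by rewrite size_rem // -ltnS prednK //; case: (R) tR.
- by apply/allP=> w /mem_rem; have /allP := adm; apply.
- by apply: balanced_perm bal; apply: boundary_faces_perm.
- by rewrite cat1s -(perm_size permR).
- by have /allP := search_reps; apply.
Qed.

Lemma settled_frame u v t : frame_label u v -> t \in orbit_reps ->
  settled (STerm false 0 u v t.1.1 t.1.2 t.2).
Proof.
move=> /frame_image_onto[i [j [ij ui vj]]] trep.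
apply: (settled_transport (T := reframe i j)).
  move=> R _ cR; split; last by rewrite eta_sum_map.
  apply: cyclic_map cR => // *; rewrite ?frame_image_rot //.
  exact: frame_label_image.
by rewrite /reframe /map_term ui vj; apply: settled_start.
Qed.

Definition conj_word (t : vertex * vertex * vertex) w :=
  foldl (fun t x => (rot t.1.1 x, rot t.1.2 x, rot t.2 x)) t w.

Lemma orbit_repsP a b c : a != b -> b != c ->
  exists w, conj_word (a, b, c) w \in orbit_reps.
Proof.
(* The first letters bring a to V0, the last ones turn about V0. *)
pose words := [seq p ++ q |
  p <- [:: [::]; [:: V5]; [:: V1]; [:: V1; V1]; [:: V2]; [:: V4]],
  q <- [:: [::]; [:: V0]; [:: V0; V0]; [:: V3]]].
have reach : all (fun a => all (fun b => all (fun c => (a != b) && (b != c) ==>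
    has (fun w => conj_word (a, b, c) w \in orbit_reps) words)
    vertices) vertices) vertices by vm_compute.
move: reach => /vertexP/(_ a)/vertexP/(_ b)/vertexP/(_ c)/implyP reach ab bc.
by have /reach/hasP[w _ wE] : (a != b) && (b != c) by [rewrite ab bc]; exists w.
Qed.

Lemma settled_color e u v a b c :
  a != b -> b != c -> frame_label u v -> e = false -> settled (STerm e 0 u v a b c).
Proof.
move=> ab bc uv ->; have [w] := orbit_repsP ab bc.
elim: w a b c u v {ab bc} uv => [|x w IHw] a b c u v uv /=.
  by move=> trep; apply: (settled_frame (t := (a, b, c))).
move=> /IHw; rewrite -(frame_label_rot u v x) in uv => /(_ _ _ uv) st.
apply: (settled_transport (T := rotate x)) => // R _ cR; split.
  apply: cyclic_map cR => //.
  - exact: rot_inj.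
  - by move=> a' b'; rewrite rotD.
  - by move=> u' v' a'; rewrite rotD.
  - by move=> u' v' a'; rewrite rotD.
  - by move=> u' v'; rewrite frame_label_rot.
by case: cR => _ /eta_sum_rotate->.
Qed.

Lemma settled_sign t : tdeg t = 0%N -> admissible t -> settled t.
Proof.
case: t => e d u v a b c /= -> /andP[/andP[/= ab bc] uv].
case: e; last exact: settled_color.
apply: (settled_transport (T := oppt)); last exact: settled_color.
move=> R _ [adm bal]; split; last first.
  rewrite /eta_sum big_map (eq_bigr _ (fun t _ => eta_term_opp t)) sumrN.
  by move/eqP; rewrite oppr_eq0 => /eqP.
split; first by rewrite all_map; apply: sub_all adm => -[].
move=> h; rewrite /boundary_faces -map_comp (eq_map faces_opp) map_comp.
by rewrite -map_flatten weight_opp bal oppr0.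
Qed.

(** Translating degrees so that the smallest one is 0 is what allows the search to
    discard triples of negative degree. *)
Lemma null_upto8 : null_upto 8.
Proof.
suff: forall N, (N <= 8)%N -> null_upto N by apply.
elim=> // N IHN N8 R szR adm bal.
have null : null_upto (size R).
  move=> R' szR'; apply: (IHN (ltnW N8)); exact: leq_trans szR' _.
case: R szR adm bal null => [|t0 R0]; first by rewrite /eta_sum big_nil.
set R := t0 :: R0 => szR adm bal null.
have exd : exists d, d \in map tdeg R by exists (tdeg t0); rewrite mem_head.
case: (ex_minnP exd) => m /mapP[t tR mE] mmin.
have dR w : w \in R -> (m <= tdeg w)%N by move=> wR; apply/mmin/map_f.
have [szR8 cR] : (size R < 8)%N /\ cyclic R by split; first exact: leq_trans szR N8.
(* Truncation is harmless, m being the smallest degree. *)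
have cS : cyclic (map (shift m) R).
  apply: cyclic_map cR => // w wR; rewrite subSn //; exact: dR.
rewrite -(eta_sum_map (subn^~ m) (fun u _ => u) (fun _ v => v)).
apply: (settled_sign (t := shift m t)).
- by rewrite mE; case: (t) => *; rewrite /= subnn.
- by case: cS => /allP + _; apply; apply: map_f.
- exact: map_f.
- by rewrite size_map.
- exact: cS.
- by rewrite size_map.
Qed.

(** * The graded set of frames *)

Definition vert (a : O6) : vertex := nth V0 vertices (nat_of_ord a).

Lemma vert_inj : injective vert.
Proof.
have vertK (a : O6) : vcode (vert a) = a.
  by apply/eqP; move: a; apply: O6_all1; vm_compute.
by move=> a b ab; apply: val_inj; rewrite /= -!vertK ab.
Qed.

Lemma vert_op a b : vert (a ◁ b) = rot (vert a) (vert b).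
Proof.
by apply/eqP; move: b; apply: O6_all1; move: a; apply: O6_all1; vm_compute.
Qed.

Lemma eta_val_vert a b c :
  eta_val [:: a; b; c] = (eta_nat (vert a) (vert b) (vert c))%:R.
Proof.
apply/eqP; move: c; apply: O6_all1; move: b; apply: O6_all1.
by move: a; apply: O6_all1; vm_compute.
Qed.

Definition frame : Type := {p : vertex * vertex | frame_label p.1 p.2}.
HB.instance Definition _ := Choice.on frame.

Definition turn (x : vertex) (p : frame) : frame :=
  exist _ (rot (val p).1 x, rot (val p).2 x)
    (etrans (frame_label_rot (val p).1 (val p).2 x) (valP p)).

Lemma turnK x : cancel (turn x) (turn (opp x)).
Proof. by move=> p; apply: val_inj; rewrite /= !rotK; case: (val p). Qed.

Lemma turnKV x : cancel (turn (opp x)) (turn x).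
Proof. by move=> p; apply: val_inj; rewrite /= !rotKV; case: (val p). Qed.

(** Neither factor would do by itself: over the integers alone, and over the
    frames alone, there are detected cycles of length five. *)
Definition graded_frame : Type := (int * frame)%type.
HB.instance Definition _ := Choice.on graded_frame.

Definition gf_act (s : graded_frame) (a : O6) : graded_frame :=
  (s.1 + 1, turn (vert a) s.2).

Definition gf_actV (s : graded_frame) (a : O6) : graded_frame :=
  (s.1 - 1, turn (opp (vert a)) s.2).

Lemma gf_actK a : cancel (gf_act^~ a) (gf_actV^~ a).
Proof. by case=> d p; rewrite /gf_act /gf_actV /= addrK turnK. Qed.

Lemma gf_actVK a : cancel (gf_actV^~ a) (gf_act^~ a).
Proof. by case=> d p; rewrite /gf_act /gf_actV /= subrK turnKV. Qed.

Lemma gf_act_dist s a b : gf_act (gf_act s b) (a ◁ b) = gf_act (gf_act s a) b.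
Proof.
congr (_, _); apply: val_inj; rewrite /= vert_op.
by rewrite -!rotD.
Qed.

Definition graded_frames : xset O6 := generated_xset gf_actK gf_actVK gf_act_dist.

Lemma graded_framesE (s : graded_frames) a : xact s (assoc_gen a) = gf_act s a.
Proof. exact: generated_actE. Qed.

(** The degree is measured from d0, meant to be a lower bound of the degrees that
    occur, so that the truncation by the absolute value is harmless. *)
Definition coded_term (d0 : int) (p : bool * chain_gen graded_frames 3) : sterm :=
  let: (s, t) := val p.2 in
  STerm p.1 `|s.1 - d0| (val s.2).1 (val s.2).2
    (vert (tnth t 0)) (vert (tnth t 1)) (vert (tnth t 2%:R)).

Lemma int_seq_lower_bound (l : seq int) : exists d, forall x, x \in l -> d <= x.
Proof.
elim: l => [|x l [d dl]]; first by exists 0.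
exists (Num.min x d) => y; rewrite inE => /orP[/eqP->|/dl dy].
  by rewrite ge_min lexx.
by rewrite ge_min dy orbT.
Qed.

Section Coding.
Variable d0 : int.

Definition coded_weight (h : nat -> vertex -> vertex -> vertex -> vertex -> int) :
  chain graded_frames 2 -> int :=
  lin_ext (fun w : chain_gen graded_frames 2 => let: (s, t) := val w in
    h `|s.1 - d0|%N (val s.2).1 (val s.2).2 (vert (tnth t 0)) (vert (tnth t 1))).

HB.instance Definition _ h := GRing.isZmodMorphism.Build
  (chain graded_frames 2) int (coded_weight h) (lin_ext_is_additive _).

Lemma coded_weight_term h (s : graded_frames) (x y : O6) :
  coded_weight h (term s [tuple x; y]) =
  if vertex_eqb (vert x) (vert y) then 0 else
  h `|s.1 - d0|%N (val s.2).1 (val s.2).2 (vert x) (vert y).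
Proof.
rewrite -[vertex_eqb _ _]/(vert x == vert y) (inj_eq vert_inj) /term.
case: insubP => [u nd uE|].
  move: nd; rewrite /nondegenerate /= andbT => /negPf->.
  by rewrite /coded_weight lin_extU uE.
by rewrite /nondegenerate /= andbT negbK => ->; rewrite raddf0.
Qed.

Lemma weight_cons_face h e d u v x y l : weight h (cons_face e d u v x y l) =
  (-1) ^+ e * (if vertex_eqb x y then 0 else h d u v x y) + weight h l.
Proof.
by rewrite /cons_face; case: ifP => _; rewrite ?mulr0 ?add0r // weight_cons.
Qed.

Lemma weight_coded_term h (p : bool * chain_gen graded_frames 3) :
  d0 <= (val p.2).1.1 ->
  weight h (faces (coded_term d0 p)) =
  coded_weight h (boundary << p.2 >>) *~ (-1) ^+ p.1.
Proof.
case: p => e [[s t] nd] /=; rewrite -term_generator /=.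
move: nd; case/tupleP: t => a t; case/tupleP: t => b t; case/tupleP: t => c t.
rewrite (tuple0 t) {t} => nd ds; have /and3P[ab bc _] := nd.
rewrite boundary_term3 // !graded_framesE !raddfD !raddfN /= !coded_weight_term.
rewrite /coded_term /= !(tnth_nth a) /= !weight_cons_face.
rewrite [weight h [::]]big_nil addr0.
have dS : `|(s.1 + 1 - d0)%R|%N = `|(s.1 - d0)%R|%N.+1 by lia.
rewrite /= dS !vert_op signrN.
by rewrite mulrzz; ring.
Qed.
End Coding.

Lemma eta_coded d0 (p : bool * chain_gen graded_frames 3) :
  eta (chain_proj (<< p.2 >> : chain graded_frames 3)) *~ (-1) ^+ p.1 =
  eta_term (coded_term d0 p).
Proof.
case: p => e [[s t] nd] /=; rewrite -term_generator chain_proj_term /=.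
rewrite eta_fun_term.
move: nd; case/tupleP: t => a t; case/tupleP: t => b t; case/tupleP: t => c t.
rewrite (tuple0 t) {t} => nd; rewrite eta_val_vert /eta_term /= !(tnth_nth a) /=.
by case: e; rewrite ?mulN1r ?mul1r ?mulrN1z.
Qed.

Lemma short_cycle_undetected (c : chain graded_frames 3) :
  boundary c = 0 -> (chain_length c < 8)%N -> eta (chain_proj c) = 0.
Proof.
move=> bc; have [r <- cE] := chain_signed_sum c => szr.
have [d0 d0r] := int_seq_lower_bound [seq (val p.2).1.1 | p <- r].
have {}d0r p : p \in r -> d0 <= (val p.2).1.1 by move=> pr; apply/d0r/map_f.
have -> : eta (chain_proj c) = eta_sum (map (coded_term d0) r).
  rewrite /eta_sum big_map cE !raddf_sum; apply: eq_bigr => p _.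
  by rewrite -(eta_coded d0) !raddfMz.
apply: null_upto8; first by rewrite size_map.
  apply/allP=> _ /mapP[p pr ->]; case: p pr => e [[s t] nd] _.
  move: nd; case/tupleP: t => a t; case/tupleP: t => b t; case/tupleP: t => c' t.
  rewrite (tuple0 t) {t} => nd; have /and3P[ab bc' _] := nd.
  rewrite /admissible /nondeg /coded_term /= !(tnth_nth a) /=.
  rewrite !(inj_eq vert_inj) ab bc'.
  exact: (valP s.2).
move=> h; rewrite /weight big_flatten /= !big_map.
transitivity (coded_weight d0 h (boundary c)); last by rewrite bc raddf0.
rewrite cE !raddf_sum; apply: eq_big_seq => p pr.
by rewrite -/(weight _ _) weight_coded_term ?d0r // !raddfMz.
Qed.

(** * The length of the cocycle *)

Lemma length_at_graded_frames : length_at eta graded_frames = 8%N.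
Proof.
apply/eqP; rewrite eqn_leq length_at_le8 /=.
have s : graded_frames by exact: (0, exist _ (V0, V1) isT).
rewrite /length_at; case: pselect => [detS|[]]; last first.
  by have [n _ det] := detected_eight s; exists n; apply/asboolP.
case: ex_minnP => n /asboolP[c [bc eta_c <-]] _.
rewrite leqNgt; apply: contra eta_c => c8.
by rewrite short_cycle_undetected.
Qed.

Theorem theorem1p2 : cocycle_length eta = EFin 8%N.
Proof.
have bound n : `[< length_value eta n >] -> (n <= 8)%N.
  by move=> /asboolP[S <-]; apply: length_at_le8.
rewrite /cocycle_length; case: pselect => [h|[]]; last by exists 8%N.
congr EFin; case: ex_maxnP => n /bound n8 nmax.
apply/eqP; rewrite eqn_leq n8; apply: nmax; apply/asboolP.
by exists graded_frames; apply: length_at_graded_frames.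
Qed.
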